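(* Let $\mathbf{k}$ be a unitary commutative ring, $\lambda\in\mathbf{k}$, and $X$ a set. Let $\mathfrak{X}_\infty$ be the set of Rota-Baxter bracketed words on $X$ and let $\diamond$ be the product of weight $\lambda$ on $\mathbf{k}\mathfrak{X}_\infty$, both as defined in the context. Then for each $w\in\mathfrak{X}_\infty$ there exists a unique alternating sequence $w_1,\dots,w_m$ (with $m\ge 0$) of elements of $X\cup\lfloor\mathfrak{X}_\infty\rfloor$ such that $$w=w_1\diamond\cdots\diamond w_m,$$ where for $m=0$ the sequence is empty and the empty product is $1$.
   Context: All algebras are unitary over a unitary commutative ring $\mathbf{k}$. For a set $Y$, $M(Y)$ is the free monoid on $Y$ and $S(Y)=M(Y)\setminus\{1\}$ is the free semigroup; $\lfloor Y\rfloor=\{\lfloor y\rfloor\mid y\in Y\}$ is a set of symbols indexed by $Y$ and disjoint from $Y$. Bracketed words: put $\mathfrak{M}_0=M(X)$ and $\mathfrak{M}_{n+1}=M(X\cup\lfloor\mathfrak{M}_n\rfloor)$ for $n\ge0$. The natural inclusions $\mathfrak{M}_n\hookrightarrow\mathfrak{M}_{n+1}$ (induced inductively by $\lfloor\mathfrak{M}_{n-1}\rfloor\hookrightarrow\lfloor\mathfrak{M}_n\rfloor$) make these a direct system; its union is the monoid $\mathfrak{M}(X)=\varinjlim\mathfrak{M}_n$ (product: concatenation, identity $1$), which carries the map $w\mapsto\lfloor w\rfloor$. Rota-Baxter bracketed words (RBWs): for subsets $Y,Z$ of $\mathfrak{M}(X)$ let $$\Lambda(Y,Z)=\bigcup_{r\ge1}(Y\lfloor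 Z\rfloor)^r\cup\bigcup_{r\ge0}(Y\lfloor Z\rfloor)^rY\cup\bigcup_{r\ge1}(\lfloor Z\rfloor Y)^r\cup\bigcup_{r\ge0}(\lfloor Z\rfloor Y)^r\lfloor Z\rfloor\cup\{1\}.$$ Put $\mathfrak{X}_0=M(X)$, $\mathfrak{X}_n=\Lambda(S(X),\mathfrak{X}_{n-1})$ for $n\ge1$, and $\mathfrak{X}_\infty=\bigcup_{n\ge0}\mathfrak{X}_n$. The depth of $w\in\mathfrak{X}_\infty$ is $\mathrm{dep}(w)=\min\{n\mid w\in\mathfrak{X}_n\}$. Every RBW $w\ne1$ has a unique standard decomposition $w=w_1\cdots w_b$ (concatenation) with the $w_i$ alternately in $S(X)$ and in $\lfloor\mathfrak{X}_\infty\rfloor$; $b$ is the breadth of $w$. Product $\diamond$: it is the $\mathbf{k}$-bilinear product on $\mathbf{k}\mathfrak{X}_\infty$ (the free $\mathbf{k}$-module on $\mathfrak{X}_\infty$) with unit $1$ defined on basis elements by induction on $\mathrm{dep}(w)+\mathrm{dep}(w')$. If $w,w'$ both have breadth $1$, then $w\diamond w'=ww'$ (concatenation) if $w\in S(X)$ or $w'\in S(X)$, and $$\lfloor\bar w\rfloor\diamond\lfloor\bar w'\rfloor=\lfloor\lfloor\bar w\rfloor\diamond\bar w'\rfloor+\lfloor\bar w\diamond\lfloor\bar w'\rfloor\rfloor+\lambda\lfloor\bar w\diamond\bar w'\rfloor,$$ with $\lfloor\cdot\rfloor$ extended linearly. For $w,w'\neq1$ with standard decompositions $w=w_1\cdots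 w_m$ and $w'=w'_1\cdots w'_{m'}$, $w\diamond w'=w_1\cdots w_{m-1}(w_m\diamond w'_1)w'_2\cdots w'_{m'}$, with the other products being concatenation, extended linearly. This product is associative. A sequence $w_1,\dots,w_m$ in $X\cup\lfloor\mathfrak{X}_\infty\rfloor$ is called alternating if no two consecutive elements are both in $\lfloor\mathfrak{X}_\infty\rfloor$, i.e. for each $1\le i\le m-1$ either $w_i$ or $w_{i+1}$ (possibly both) is in $X$.
   Formalization: The ring k is assumed nonzero (1 ≠ 0): over the zero ring the module on the Rota-Baxter bracketed words is 0, so every alternating sequence, e.g. the empty one and ⌊1⌋, has product equal to w, and uniqueness fails. *)

(* Defs.v *)
From HB Require Import structures.
From mathcomp Require Import all_boot all_order all_algebra.
From mathcomp Require Import boolp classical_sets finmap.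
From mathcomp Require Import monalg.

Set Implicit Arguments.
Unset Strict Implicit.
Unset Printing Implicit Defensive.

Import GRing.Theory.
Local Open Scope classical_set_scope.
Local Open Scope ring_scope.

(* The monoid of all bracketed words on X, as words in the letters x and
   |_w_|, where w is itself a bracketed word.  It is the union of the stages
   M_0 = M(X), M_(n+1) = M(X u |_M_n_|): see bigcup_stage. *)
Inductive letter (X : Type) : Type :=
| Var of X
| Br of seq (letter X).

Arguments Var {X} x.
Arguments Br {X} w.

Definition word (X : Type) := seq (letter X).

Section LetterChoice.
Variable X : choiceType.

Fixpoint letter_encode (l : letter X) : GenTree.tree X :=
  match l with
  | Var x => GenTree.Leaf x
  | Br w => GenTree.Node 0 (map letter_encode w)
  end.

Fixpoint letter_decode (t : GenTree.tree X) : letter X :=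
  match t with
  | GenTree.Leaf x => Var x
  | GenTree.Node _ ts => Br (map letter_decode ts)
  end.

Lemma letter_encodeK : cancel letter_encode letter_decode.
Proof.
rewrite /cancel; fix IH 1; case=> [x|w] /=; first exact: erefl.
congr Br.
by elim: w => [|l w IHw] /=; [exact: erefl | rewrite IH IHw].
Qed.

HB.instance Definition _ := Choice.copy (letter X) (can_type letter_encodeK).
HB.instance Definition _ := Choice.copy (word X) (seq (letter X)).

Lemma cat_unit (u v : word X) : u ++ v = [::] -> u = [::] /\ v = [::].
Proof. by case: u. Qed.

HB.instance Definition _ := Choice_isMonomialDef.Build (word X)
  (@catA (letter X)) (@cat0s (letter X)) (@cats0 (letter X)) cat_unit.

End LetterChoice.

Section WordInd.
Variable X : Type.

Fixpoint ldepth (l : letter X) : nat :=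
  if l is Br w then (foldr maxn 0 (map ldepth w)).+1 else 0%N.

(* Bracket nesting depth. *)
Definition wdepth (w : word X) : nat := foldr maxn 0%N (map ldepth w).

Lemma wdepth_cons l w : wdepth (l :: w) = maxn (ldepth l) (wdepth w).
Proof. by []. Qed.

Lemma wdepth_cat u v : wdepth (u ++ v) = maxn (wdepth u) (wdepth v).
Proof. by elim: u => [|l u IHu]; rewrite ?max0n //= !wdepth_cons IHu maxnA. Qed.

Lemma ldepth_Br w : ldepth (Br w) = (wdepth w).+1.
Proof. by []. Qed.

End WordInd.

Section RBWords.
Variable X : choiceType.
Implicit Types (Y Z A B : set (word X)) (w : word X).

Definition free_monoid (L : set (letter X)) : set (word X) :=
  [set w | forall l, l \in (w : seq (letter X)) -> L l].

Fixpoint stage (n : nat) : set (word X) :=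
  if n is n'.+1 then free_monoid (range Var `|` Br @` stage n')
  else free_monoid (range Var).

Lemma stage_depth n w : (wdepth w <= n)%N -> stage n w.
Proof.
elim: n w => [|n IHn]; elim=> [//|l w IHw] //; rewrite wdepth_cons geq_max.
  case/andP=> dl dw l'; rewrite inE => /orP[/eqP->|]; last exact: IHw.
  by case: l dl => // x _; exists x.
case/andP=> dl dw l'; rewrite inE => /orP[/eqP->|]; last exact: IHw.
case: l dl => [x|u] dl; first by left; exists x.
by right; exists u => //; apply: IHn.
Qed.

Lemma bigcup_stage : \bigcup_n stage n = setT.
Proof. by apply/seteqP; split=> // w _; exists (wdepth w); last exact: stage_depth. Qed.

(* M(X), S(X), and X itself viewed as a set of words *)
Definition MX : set (word X) := free_monoid (range Var).
Definition SX : set (word X) := MX `\` [set [::]].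
Definition gens : set (word X) := [set [:: Var x] | x in setT].

Definition cat_set A B : set (word X) := [set (u ++ v)%SEQ | u in A & v in B].
Definition pow_set A (r : nat) : set (word X) := iter r (cat_set A) [set [::]].
Definition br_set Z : set (word X) := [set [:: Br z] | z in Z].

Definition Lambda Y Z : set (word X) :=
  \bigcup_(r in [set r | (1 <= r)%N]) pow_set (cat_set Y (br_set Z)) r
  `|` \bigcup_r cat_set (pow_set (cat_set Y (br_set Z)) r) Y
  `|` \bigcup_(r in [set r | (1 <= r)%N]) pow_set (cat_set (br_set Z) Y) r
  `|` \bigcup_r cat_set (pow_set (cat_set (br_set Z) Y) r) (br_set Z)
  `|` [set [::]].

Fixpoint RBW_n (n : nat) : set (word X) :=
  if n is n'.+1 then Lambda SX (RBW_n n') else MX.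

Definition RBW : set (word X) := \bigcup_n RBW_n n.

Definition alternating (s : seq (word X)) : Prop :=
  (forall i, (i < size s)%N -> (gens `|` br_set RBW) (nth [::] s i)) /\
  (forall i, (i.+1 < size s)%N ->
     gens (nth [::] s i) \/ gens (nth [::] s i.+1)).

(* The standard decomposition: maximal runs of letters of X, and single
   brackets. *)
Fixpoint std_decomp (w : word X) : seq (word X) :=
  match w with
  | [::] => [::]
  | Br u :: w' => [:: Br u] :: std_decomp w'
  | Var x :: w' =>
      match std_decomp w' with
      | (Var y :: b) :: bs => (Var x :: Var y :: b) :: bs
      | bs => [:: Var x] :: bs
      end
  end.

Definition is_var (l : letter X) := if l is Var _ then true else false.

Lemma flatten_std_decomp w : flatten (std_decomp w) = w.
Proof.
elim: w => [//|[x|u] w IHw] /=; last by rewrite IHw.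
by move: IHw; case: (std_decomp w) => [|[|[y|u] b] bs] /= <-.
Qed.

Lemma std_decomp_nil w : std_decomp w = [::] -> w = [::].
Proof. by move=> dw; rewrite -(flatten_std_decomp w) dw. Qed.

Lemma mem_last_std_decomp w : w != [::] ->
  last [::] (std_decomp w) \in std_decomp w.
Proof.
case/lastP: (std_decomp w) (@std_decomp_nil w) => [/(_ erefl)->//|bs b _ _].
by rewrite last_rcons mem_rcons mem_head.
Qed.

Lemma mem_head_std_decomp w : w != [::] ->
  head [::] (std_decomp w) \in std_decomp w.
Proof.
case: (std_decomp w) (@std_decomp_nil w) => [/(_ erefl)->//|b bs _ _].
exact: mem_head.
Qed.

Lemma SX_Var x w : MX w -> SX (Var x :: w).
Proof. by move=> Mw; split=> // l; rewrite inE => /orP[/eqP->|/Mw//]; exists x. Qed.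

(* Each term of the decomposition is in S(X) or is a bracket occurring in w. *)
Lemma std_decomp_mem w b : b \in std_decomp w ->
  SX b \/ exists2 u, Br u \in (w : seq (letter X)) & b = [:: Br u].
Proof.
elim: w b => [//|l w IHw] b.
have {}IHw c : c \in std_decomp w -> SX c \/
    exists2 u, Br u \in l :: w & c = [:: Br u].
  by case/IHw=> [|[u uw ->]]; [left|right; exists u; rewrite // inE uw orbT].
case: l IHw => [x|u] /= IHw; last first.
  rewrite inE => /orP[/eqP->|/IHw//].
  by right; exists u; rewrite ?mem_head.
have SX1 : SX [:: Var x] by apply: SX_Var.
case: (std_decomp w) IHw => [|[|[y|u] c] bs] IHw.
- by rewrite inE => /eqP->; left.
- by rewrite inE => /orP[/eqP->|/IHw//]; left.
- rewrite inE => /orP[/eqP->|bbs]; last by apply: IHw; rewrite inE bbs orbT.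
  case: (IHw _ (mem_head _ _)) => [[My _]|[u _ //]].
  by left; apply: SX_Var.
- by rewrite inE => /orP[/eqP->|/IHw//]; left.
Qed.

(* No two consecutive terms are in S(X); two consecutive brackets do not occur
   when w is a Rota-Baxter word, by RBWP. *)
Lemma std_decomp_alt w :
  sorted (fun b b' => ~~ (has is_var b && has is_var b')) (std_decomp w).
Proof.
elim: w => [//|[x|u] w] /=; last by case: (std_decomp w).
have := @std_decomp_mem w.
case: (std_decomp w) => [|[|[y|u] b] bs] // mem_w.
- by case: bs {mem_w}.
- rewrite /= => ->; rewrite andbT.
  by case: (mem_w _ (mem_head _ _)) => [[/(_ _ (mem_head _ _))[]]|[v _ [_ ->]]].
Qed.

Lemma std_decomp_SX w : SX w -> std_decomp w = [:: w].
Proof.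
case=> + w0; elim: w w0 => [[]//|l w IHw _ Mw] /=.
have [x _ lE] := Mw l (mem_head _ _); rewrite -{}lE in Mw *.
case: w => [//|l2 w] in IHw Mw *.
rewrite IHw //; last by move=> l' l'w; apply: Mw; rewrite inE l'w orbT.
by have [|y _ <-] := Mw l2 _; first by rewrite !inE eqxx orbT.
Qed.

Lemma std_decomp_Var x w : is_var (head (Br [::]) (head [::] (std_decomp (Var x :: w)))).
Proof. by rewrite /=; case: (std_decomp w) => [|[|[]]]. Qed.

Lemma std_decomp_rcons_Br w u :
  std_decomp (rcons w (Br u)) = rcons (std_decomp w) [:: Br u].
Proof.
by elim: w => [//|[x|v] w IHw] /=; rewrite IHw //; case: (std_decomp w) => [|[|[]]].
Qed.

Lemma std_decomp_rcons_Var w x u :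
  last [::] (std_decomp (rcons w (Var x))) != [:: Br u].
Proof.
apply/eqP => e; have := flatten_std_decomp (rcons w (Var x)).
case/lastP: (std_decomp _) e => [//|bs b]; rewrite last_rcons => ->.
rewrite -cats1 flatten_cat /= cats1 => /(congr1 (last (Br [::]))).
by rewrite !last_rcons.
Qed.

Lemma cat_setA A B C : cat_set A (cat_set B C) = cat_set (cat_set A B) C.
Proof.
apply/seteqP; split=> w.
  by case=> u Au [_ [v Bv [t Ct <-]] <-]; exists (u ++ v); [exists u => //; exists v|exists t; rewrite ?catA].
by case=> _ [u Au [v Bv <-]] [t Ct <-]; exists u => //; exists (v ++ t); [exists v => //; exists t|rewrite catA].
Qed.

Lemma cat_set0s A : cat_set [set [::]] A = A.
Proof. by apply/seteqP; split=> w; [case=> _ -> [u Au <-]|move=> Aw; exists [::] => //; exists w]. Qed.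

Lemma cat_sets0 A : cat_set A [set [::]] = A.
Proof.
apply/seteqP; split=> w; first by case=> u Au [_ -> <-]; rewrite cats0.
by move=> Aw; exists w => //; exists [::]; rewrite ?cats0.
Qed.

Lemma cat_pow_set A B r :
  cat_set A (pow_set (cat_set B A) r) = cat_set (pow_set (cat_set A B) r) A.
Proof.
elim: r => [|r IHr]; first by rewrite /= cat_set0s cat_sets0.
by rewrite /pow_set /= -/(pow_set _ r) -/(pow_set _ r) -!cat_setA IHr.
Qed.

Definition adj (l l' : letter X) := is_var l || is_var l'.

(* w has all its brackets in |_Z_| and no two consecutive brackets *)
Definition good Z w := (forall u, Br u \in (w : seq (letter X)) -> Z u) /\ sorted adj w.

Definition hd_var w := if w is l :: _ then is_var l else true.
Definition tl_var w := last true (map is_var w).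

Lemma sorted_adj_cat u v :
  sorted adj (u ++ v) = [&& sorted adj u, sorted adj v & (tl_var u || hd_var v)].
Proof.
case/lastP: u => [|u l]; first by rewrite /= andbT.
rewrite /tl_var map_rcons last_rcons; case: u => [|a u] /=.
  by case: v => [|b v]; rewrite ?orbT //= andbC.
rewrite cat_path last_rcons; congr (_ && _).
by case: v => [|b v]; rewrite ?orbT //= andbC.
Qed.

Lemma good_cat Z u v :
  good Z (u ++ v) <-> [/\ good Z u, good Z v & tl_var u || hd_var v].
Proof.
rewrite /good sorted_adj_cat; split=> [[Z_uv /and3P[-> -> ->]]|].
  by split=> //; split=> // t tu; apply: Z_uv; rewrite mem_cat tu ?orbT.
case=> [[Zu ->] [Zv ->] ->]; split=> // t.
by rewrite mem_cat => /orP[/Zu|/Zv].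
Qed.

Lemma MX_var w : MX w -> all is_var w.
Proof. by move=> Mw; apply/allP=> l /Mw[x _ <-]. Qed.

Lemma MXP w : MX w <-> all is_var w.
Proof.
split=> [/MX_var//|/allP vw l lw]; move: (vw l lw).
by case: l {lw} => // x _; exists x.
Qed.

Lemma good_MX Z w : MX w -> [/\ good Z w, hd_var w & tl_var w].
Proof.
move/MX_var=> vw; split; last 2 first.
- by case: w vw => //= l w /andP[].
- by case/lastP: w vw => // w l; rewrite all_rcons /tl_var map_rcons last_rcons => /andP[].
split=> [u /(allP vw)//|].
by case: w vw => //= l w /andP[vl]; elim: w l vl => //= l' w IHw l vl /andP[vl' /IHw->//]; rewrite /adj vl.
Qed.

Lemma good_br Z w : br_set Z w -> good Z w.
Proof. by case=> z Zz <-; split=> // u; rewrite inE => /eqP[->]. Qed.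

Lemma tl_var_cat u v : tl_var v -> tl_var u -> tl_var (u ++ v).
Proof. by rewrite /tl_var map_cat last_cat; case/lastP: v => [//|v l]; rewrite map_rcons !last_rcons. Qed.

Lemma hd_var_cat u v : hd_var u -> hd_var v -> hd_var (u ++ v).
Proof. by case: u. Qed.

Lemma LambdaP Z w : Lambda SX Z w <-> good Z w.
Proof.
set P := cat_set SX (br_set Z); set Q := cat_set (br_set Z) SX.
have goodP r u : pow_set P r u -> good Z u /\ hd_var u.
  elim: r u => [|r IHr] u; first by move=> ->.
  case=> _ [a [Ma a0] [b brb <-]] [c /IHr[gc hc] <-].
  have [ga ha ta] := good_MX Z Ma.
  split; last by case: a a0 {Ma ga ta} ha => [/(_ erefl)|].
  apply/good_cat; split=> //; last by rewrite hc orbT.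
  by apply/good_cat; split=> //; [exact: good_br|rewrite ta].
have goodQ r u : pow_set Q r u -> good Z u /\ tl_var u.
  elim: r u => [|r IHr] u; first by move=> ->.
  case=> _ [b brb [a [Ma a0] <-]] [c /IHr[gc tc] <-].
  have [ga ha ta] := good_MX Z Ma.
  have tba : tl_var (b ++ a).
    rewrite /tl_var map_cat last_cat; case/lastP: a a0 ta {Ma ga ha} => [/(_ erefl)//|a l _].
    by rewrite /tl_var map_rcons !last_rcons.
  split; last by apply: tl_var_cat.
  apply/good_cat; split=> //; last by rewrite tba.
  by apply/good_cat; split=> //; [exact: good_br|rewrite ha orbT].
split.
  case=> [[[[|]|]|]|->] //.
  - by case=> r _ /goodP[].
  - case=> r _ [u /goodP[gu _] [v [Mv _] <-]]; have [gv hv _] := good_MX Z Mv.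
    by apply/good_cat; split=> //; rewrite hv orbT.
  - by case=> r _ /goodQ[].
  - case=> r _ [u /goodQ[gu tu] [v brv <-]].
    by apply/good_cat; split=> //; [exact: good_br|rewrite tu].
suff H : good Z w -> w = [::] \/
    (if hd_var w then (exists r, pow_set P r.+1 w) \/ (exists r, cat_set (pow_set P r) SX w)
     else (exists r, pow_set Q r.+1 w) \/ (exists r, cat_set (pow_set Q r) (br_set Z) w)).
  case/H=> [->|]; first by right.
  case: ifP => _ [[r Hr]|[r Hr]].
  - by left; left; left; left; exists r.+1.
  - by left; left; left; right; exists r.
  - by left; left; right; exists r.+1.
  - by left; right; exists r.
elim: w => [|l w IHw] gw; first by left.
right; have [_ gw' adjl] : [/\ good Z [:: l], good Z w & tl_var [:: l] || hd_var w].
  by apply/good_cat.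
have {IHw} := IHw gw'.
case: l gw adjl => [x|u] [Zw _] /= hw.
  case=> [->|]; first by right; exists 0%N; rewrite cat_set0s; apply: SX_Var.
  have SX1 : SX [:: Var x] by apply: SX_Var.
  case: ifP => _ [[r Hr]|[r Hr]].
  - left; exists r; case: Hr => _ [a [Ma _] [b brb <-]] [c Pc <-].
    exists (Var x :: a ++ b); last by exists c.
    by exists (Var x :: a); [apply: SX_Var|exists b].
  - right; exists r; case: r Hr => [|r].
      by rewrite !cat_set0s => -[Mw _]; apply: SX_Var.
    rewrite /pow_set /= -!cat_setA => -[a [Ma _] [b Hb <-]].
    by exists (Var x :: a); [apply: SX_Var|exists b].
  - right; exists r.+1; rewrite /P -cat_pow_set.
    by exists [:: Var x] => //; exists w.
  - left; exists r; rewrite /pow_set /= -/(pow_set P r) /P -cat_setA cat_pow_set.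
    by exists [:: Var x] => //; exists w.
have br1 : br_set Z [:: Br u] by exists u => //; apply: Zw; rewrite mem_head.
case=> [->|]; first by right; exists 0%N; rewrite cat_set0s.
rewrite {}[hd_var w]hw => -[[r Hr]|[r Hr]].
- by right; exists r.+1; rewrite /Q -cat_pow_set; exists [:: Br u] => //; exists w.
- left; exists r; rewrite /pow_set /= -/(pow_set Q r) /Q -cat_setA cat_pow_set.
  by exists [:: Br u] => //; exists w.
Qed.

Lemma RBW_nS n : RBW_n n `<=` RBW_n n.+1.
Proof.
elim: n => [|n IHn] w; first by move=> Mw; have [gw _ _] := good_MX (RBW_n 0) Mw; apply/LambdaP.
case/LambdaP=> Zw sw; apply/LambdaP; split=> // u /Zw; exact: IHn.
Qed.

Lemma RBW_n_le n m : (n <= m)%N -> RBW_n n `<=` RBW_n m.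
Proof.
move/subnK <-; elim: (m - n)%N => [//|d IHd] w /IHd; exact: RBW_nS.
Qed.

Lemma RBWP w : RBW w <-> good RBW w.
Proof.
split=> [[[|n] _]|[Zw sw]].
- by move=> Mw; have [] := good_MX RBW Mw.
- by case/LambdaP=> Zw sw; split=> // u /Zw; exists n.
have [n Hn] : exists n, forall u, Br u \in (w : seq (letter X)) -> RBW_n n u.
  elim: w {sw} Zw => [|l w IHw] Zw; first by exists 0%N.
  have [|n Hn] := IHw; first by move=> u uw; apply: Zw; rewrite inE uw orbT.
  case: l Zw => [x|u] Zw; first by exists n => u; rewrite inE => /Hn.
  have [m _ Hm] := Zw u (mem_head _ _).
  exists (maxn n m) => v; rewrite inE => /orP[/eqP[->]|/Hn].
    exact: RBW_n_le (leq_maxr _ _) _ Hm.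
  exact: RBW_n_le (leq_maxl _ _) _.
by exists n.+1 => //; apply/LambdaP.
Qed.

End RBWords.

Arguments stage {X} n.
Arguments MX {X}.
Arguments SX {X}.
Arguments gens {X}.
Arguments RBW_n {X} n.
Arguments RBW {X}.

Section Diamond.
Variables (k : comNzRingType) (lam : k) (X : choiceType).

(* The free k-module on all bracketed words; its ring product is the bilinear
   extension of concatenation.  k RBW is its submodule spanned by RBW, closed
   under dia by in_kRBW_dia.  The ring k is nontrivial: over the zero ring all
   words would be equal in kW. *)
Local Notation kW := {malg k[word X]}.
Implicit Types (u v w : word X) (f g : kW).

Definition lin_ext (F : word X -> kW) f : kW :=
  \sum_(w <- msupp f) f@_w *: F w.

Definition brk : kW -> kW := lin_ext (fun w => << ([:: Br w] : word X) >>).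

(* The product of two words of breadth at most 1, given the product rec on
   pairs of smaller depth. *)
Definition block_dia (rec : word X -> word X -> kW) (b b' : word X) : kW :=
  match b, b' with
  | [:: Br u], [:: Br v] =>
      brk (rec [:: Br u] v) + brk (rec u [:: Br v]) + lam *: brk (rec u v)
  | _, _ => << (b ++ b' : word X) >>
  end.

(* The recursion on dep w + dep w' is run with n as fuel; dia_word supplies
   enough of it, so that the base case is never reached: see dia_rec_fuel. *)
Fixpoint dia_rec (n : nat) (w w' : word X) : kW :=
  if n isn't n'.+1 then 0 else
  if w == [::] then << w' >> else
  if w' == [::] then << w >> else
  let bs := std_decomp w in
  let bs' := std_decomp w' in
  << (flatten (take (size bs).-1 bs) : word X) >>
  * block_dia (dia_rec n') (last [::] bs) (head [::] bs')
  * << (flatten (behead bs') : word X) >>.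

Definition dia_word (w w' : word X) : kW :=
  dia_rec (wdepth w + wdepth w').+1 w w'.

Definition dia f g : kW :=
  lin_ext (fun u => lin_ext (fun v => dia_word u v) g) f.

(* dia is associative on k RBW; dia_prod nests to the right. *)
Definition dia_prod (s : seq (word X)) : kW := \big[dia/1]_(w <- s) << w >>.

Lemma lin_extEw F f (d : {fset word X}) : (msupp f `<=` d)%fset ->
  lin_ext F f = \sum_(w <- d) f@_w *: F w.
Proof.
move=> sfd; rewrite /lin_ext (big_fset_incl _ sfd) // => w _ /mcoeff_outdom ->.
by rewrite scale0r.
Qed.

Lemma lin_extP F a f g : lin_ext F (a *: f + g) = a *: lin_ext F f + lin_ext F g.
Proof.
pose d := (msupp f `|` msupp g)%fset.
rewrite (@lin_extEw F f d) ?fsubsetUl // (@lin_extEw F g d) ?fsubsetUr //.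
rewrite (@lin_extEw F _ d).
  rewrite scaler_sumr -big_split /=; apply: eq_bigr => w _.
  by rewrite mcoeffD mcoeffZ scalerDl scalerA.
exact: fsubset_trans (msuppD_le _ _) (fsetSU _ (msuppZ_le _ _)).
Qed.

Lemma lin_extU F w : lin_ext F << w >> = F w.
Proof. by rewrite /lin_ext msuppU1 big_seq_fset1 mcoeffUU scale1r. Qed.

Lemma lin_ext_id f : lin_ext (fun w => << w >>) f = f.
Proof.
rewrite [RHS]monalgE; apply: eq_bigr => w _; apply/malgP => w'.
by rewrite mcoeffZ !mcoeffU mulrnAr mulr1.
Qed.

Lemma dia_linl a f f' g : dia (a *: f + f') g = a *: dia f g + dia f' g.
Proof. exact: lin_extP. Qed.

Lemma dia_linr a f g g' : dia f (a *: g + g') = a *: dia f g + dia f g'.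
Proof.
rewrite /dia /lin_ext scaler_sumr -big_split /=; apply: eq_bigr => w _.
by rewrite -!/(lin_ext _ _) lin_extP scalerDr !scalerA mulrC.
Qed.

Lemma diaU u v : dia << u >> << v >> = dia_word u v.
Proof. by rewrite /dia !lin_extU. Qed.

Lemma wdepth_last_head w w' :
  (wdepth (last [::] (std_decomp w)) + wdepth (head [::] (std_decomp w'))
   <= wdepth w + wdepth w')%N.
Proof.
apply: leq_add.
  rewrite -{2}(flatten_std_decomp w).
  case/lastP: (std_decomp w) => [//|bs b].
  by rewrite last_rcons -cats1 flatten_cat /= cats0 wdepth_cat leq_maxr.
rewrite -{2}(flatten_std_decomp w').
by case: (std_decomp w') => [//|b bs] /=; rewrite wdepth_cat leq_maxl.
Qed.

Lemma eq_block_dia rec rec' b b' :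
  (forall u v, (wdepth u + wdepth v < wdepth b + wdepth b')%N ->
     rec u v = rec' u v) ->
  block_dia rec b b' = block_dia rec' b b'.
Proof.
case: b => [|[x|u] [|l b]]; [by []|by []|by []| |by []].
case: b' => [|[y|v] [|l b']]; [by []|by []|by []| |by []] => eq_rec.
have dep (t : word X) : wdepth [:: Br t] = (wdepth t).+1 by rewrite wdepth_cons maxn0.
rewrite !dep in eq_rec *; rewrite /block_dia (eq_rec [:: Br u] v) ?dep; last first.
  by rewrite addnS.
rewrite (eq_rec u [:: Br v]) ?dep; last by rewrite addSn.
by rewrite (eq_rec u v) // addSn addnS ltnS.
Qed.

Lemma dia_rec_fuel n w w' : (wdepth w + wdepth w' < n)%N ->
  dia_rec n w w' = dia_word w w'.
Proof.
suff H m : (wdepth w + wdepth w' < n)%N -> (wdepth w + wdepth w' < m)%N ->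
    dia_rec n w w' = dia_rec m w w'.
  by move=> ltn; apply: H.
elim: n m w w' => [//|n IHn] [//|m] w w' ltn ltm /=.
case: (w == [::]); first by [].
case: (w' == [::]); first by [].
rewrite (@eq_block_dia _ (dia_rec m)) // => u v.
move=> /leq_trans/(_ (wdepth_last_head w w')) lt_uv.
by apply: IHn; apply: leq_trans lt_uv _.
Qed.

(* With bilinearity, the equations dia1l, dia1r, dia_SX, dia_Br and
   dia_std_decomp are the recursive definition of the Rota-Baxter product. *)
Lemma dia1l : left_id 1 dia.
Proof.
move=> f; rewrite /dia lin_extU -[RHS]lin_ext_id; apply: eq_bigr => w _.
by rewrite /dia_word /=.
Qed.

Lemma dia1r : right_id 1 dia.
Proof.
move=> f; rewrite /dia -[RHS]lin_ext_id; apply: eq_bigr => w _.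
by rewrite lin_extU /dia_word /=; case: eqP => // ->.
Qed.

Lemma dia_block b b' : (SX `|` br_set setT) b -> (SX `|` br_set setT) b' ->
  dia << b >> << b' >> = block_dia dia_word b b'.
Proof.
have blockE c : (SX `|` br_set setT) c -> std_decomp c = [:: c] /\ c != [::].
  by case=> [Sc|[u _ <-]]; split=> //; [exact: std_decomp_SX|case: Sc => _ /eqP].
move=> /blockE[bE b0] /blockE[bE' b0']; rewrite diaU /dia_word /= (negPf b0) (negPf b0').
rewrite bE bE' /= mul1r mulr1.
by apply: eq_block_dia => u v; exact: dia_rec_fuel.
Qed.

Lemma dia_SX b b' : (SX `|` br_set setT) b -> (SX `|` br_set setT) b' ->
  SX b \/ SX b' -> dia << b >> << b' >> = << (b ++ b' : word X) >>.
Proof.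
have SXBr u (c : word X) : ~ SX (Br u :: c) by case=> /(_ _ (mem_head _ _))[].
move=> Hb Hb' Sbb'; rewrite dia_block //; case: b Sbb' {Hb} => [|[x|u] [|l b]] //.
by case: b' {Hb'} => [|[y|v] [|l' b']] // [] /SXBr.
Qed.

Lemma dia_Br u v : dia << ([:: Br u] : word X) >> << ([:: Br v] : word X) >> =
  brk (dia << ([:: Br u] : word X) >> << v >>)
  + brk (dia << u >> << ([:: Br v] : word X) >>)
  + lam *: brk (dia << u >> << v >>).
Proof. by rewrite dia_block; [rewrite !diaU|right; exists u|right; exists v]. Qed.

Lemma dia_std_decomp w w' : w <> [::] -> w' <> [::] ->
  dia << w >> << w' >> =
  << (flatten (take (size (std_decomp w)).-1 (std_decomp w)) : word X) >>
  * dia << last [::] (std_decomp w) >> << head [::] (std_decomp w') >>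
  * << (flatten (behead (std_decomp w')) : word X) >>.
Proof.
move=> /eqP w0 /eqP w0'; rewrite [in RHS]dia_block.
- rewrite diaU /dia_word /= (negPf w0) (negPf w0').
  rewrite (@eq_block_dia _ dia_word) // => u v /leq_trans/(_ (wdepth_last_head w w')).
  exact: dia_rec_fuel.
- have := mem_last_std_decomp w0.
  by case/std_decomp_mem=> [|[u _ ->]]; [left|right; exists u].
- have := mem_head_std_decomp w0'.
  by case/std_decomp_mem=> [|[u _ ->]]; [left|right; exists u].
Qed.

Lemma dia_word_rcons_cons u a b v :
  dia_word (rcons u (Br a)) (Br b :: v) =
  << u >> * dia << ([:: Br a] : word X) >> << ([:: Br b] : word X) >> * << v >>.
Proof.
rewrite -diaU dia_std_decomp; [|by case: u|by []].
rewrite std_decomp_rcons_Br last_rcons size_rcons -cats1 take_size_cat //=.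
by rewrite !flatten_std_decomp.
Qed.

Lemma dia_word_cat w w' : tl_var w || hd_var w' -> dia_word w w' = << (w ++ w' : word X) >>.
Proof.
case: (eqVneq w [::]) => [->|w0] tl_hd; first by rewrite /dia_word.
case: (eqVneq w' [::]) => [->|w0'] in tl_hd *.
  by rewrite /dia_word /= (negPf w0) cats0.
rewrite -diaU dia_std_decomp; [|exact/eqP|exact/eqP].
set b := last _ _; set b' := head _ _.
have -> : dia << b >> << b' >> = << (b ++ b' : word X) >>.
  have bw : b \in std_decomp w by exact: mem_last_std_decomp.
  have bw' : b' \in std_decomp w' by exact: mem_head_std_decomp.
  have inSB c t : c \in std_decomp t -> (SX `|` br_set setT) c.
    by case/std_decomp_mem=> [|[u _ ->]]; [left|right; exists u].
  apply: dia_SX; [exact: inSB bw|exact: inSB bw'|].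
  case/orP: tl_hd => [tl|hd].
    left; have [//|[u _ bE]] := std_decomp_mem bw.
    case/lastP: w @b tl bE {w0 bw} => // w [x|t] /=.
      by move=> _ /eqP; rewrite (negPf (std_decomp_rcons_Var w x u)).
    by rewrite /tl_var map_rcons last_rcons.
  right; have [//|[u _ bE]] := std_decomp_mem bw'.
  case: w' @b' hd bE {w0' bw'} => [//|[x|t] w'] //= _.
  by case: (std_decomp w') => [|[|[]]].
have ringE (s t : word X) : << s >> * << t >> = << (s ++ t : word X) >> :> kW.
  by rewrite -[LHS]/(fgmul _ _) fgmulUU mulr1.
rewrite !ringE /b /b'; congr << _ >>.
move: (flatten_std_decomp w) (flatten_std_decomp w').
case/lastP: (std_decomp w) => [|bs c]; case: (std_decomp w') => [|c' bs'];
  rewrite ?last_rcons ?size_rcons -?cats1 ?take_size_cat // ?flatten_cat /= ?cats0;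
  by move=> <- <-; rewrite ?cats0 ?catA.
Qed.

Definition in_kRBW f := forall w, w \in msupp f -> RBW w.

Lemma in_kRBW0 : in_kRBW 0.
Proof. by move=> w; rewrite msupp0. Qed.

Lemma in_kRBWD f g : in_kRBW f -> in_kRBW g -> in_kRBW (f + g).
Proof. by move=> Hf Hg w /(fsubsetP (msuppD_le _ _)); rewrite inE => /orP[/Hf|/Hg]. Qed.

Lemma in_kRBWZ a f : in_kRBW f -> in_kRBW (a *: f).
Proof. by move=> Hf w /(fsubsetP (msuppZ_le _ _))/Hf. Qed.

Lemma in_kRBWU w : RBW w -> in_kRBW << w >>.
Proof. by move=> Hw w'; rewrite msuppU1 inE => /eqP->. Qed.

Lemma in_kRBW_lin_ext F f : in_kRBW f -> (forall w, RBW w -> in_kRBW (F w)) ->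
  in_kRBW (lin_ext F f).
Proof.
move=> Hf HF; rewrite /lin_ext big_seq.
elim/big_ind: _ => [|g h|w wf]; [exact: in_kRBW0|exact: in_kRBWD|].
by apply/in_kRBWZ/HF/Hf.
Qed.

(* k RBW is closed under dia. *)
Lemma in_kRBW_dia f g : in_kRBW f -> in_kRBW g -> in_kRBW (dia f g).
Proof.
suff H n u v : (wdepth u + wdepth v < n)%N -> RBW u -> RBW v ->
    in_kRBW (dia_word u v).
  move=> Hf Hg; apply: in_kRBW_lin_ext => // u Hu.
  by apply: in_kRBW_lin_ext => // v Hv; apply: (H (wdepth u + wdepth v).+1).
elim: n u v => [//|n IHn] u v dep_uv Hu Hv.
have [tl_hd|] := boolP (tl_var u || hd_var v).
  rewrite dia_word_cat //; apply/in_kRBWU/RBWP/good_cat.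
  by split=> //; apply/RBWP.
rewrite negb_or; case/lastP: u dep_uv Hu => [//|u [x|a]];
  rewrite {1}/tl_var map_rcons last_rcons // => + + /=.
case: v Hv => [//|[//|b] v] Hv dep_uv Hu _.
rewrite dia_word_rcons_cons.
have RBr (t : word X) : RBW t -> RBW [:: Br t].
  by move=> Ht; apply/RBWP; split=> // s; rewrite inE => /eqP[->].
move: dep_uv Hu; rewrite -cats1 -[Br b :: v]cat1s !wdepth_cat => dep_uv.
have {dep_uv} dep_ab : (wdepth [:: Br a] + wdepth [:: Br b] < n.+1)%N.
  by apply: leq_ltn_trans dep_uv; apply: leq_add; rewrite ?leq_maxr ?leq_maxl.
move: Hv; rewrite -[Br b :: v]cat1s.
move=> /RBWP/good_cat[[Zb _] gv /= hv] /RBWP/good_cat[gu [Za _]].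
rewrite /= orbF => tu.
have {}Za : RBW a by apply: Za; rewrite mem_head.
have {}Zb : RBW b by apply: Zb; rewrite mem_head.
have dep (t : word X) : wdepth [:: Br t] = (wdepth t).+1 by rewrite wdepth_cons maxn0.
have [h1 Hh1 hE] : exists2 h1, in_kRBW h1 &
    dia << ([:: Br a] : word X) >> << ([:: Br b] : word X) >> = brk h1.
  exists (dia_word [:: Br a] b + dia_word a [:: Br b] + lam *: dia_word a b).
    rewrite !dep addSn addnS !ltnS in dep_ab.
    apply: in_kRBWD; [apply: in_kRBWD|apply: in_kRBWZ]; apply: IHn => //;
      rewrite ?dep ?addSn ?addnS //; [exact: RBr|exact: RBr|exact: ltnW].
  rewrite dia_Br !diaU /brk [in RHS]addrC lin_extP [RHS]addrC.
  by rewrite -[dia_word [:: Br a] b in RHS]scale1r lin_extP scale1r.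
move=> w /msuppM_le[_ [s [/msuppM_le[p [q [+ + ->]]] + ->]]].
rewrite !msuppU1 !inE => /eqP-> + /eqP->.
rewrite hE => qh.
have [t Ht ->] : exists2 t, RBW t & q = [:: Br t].
  move: qh; rewrite -mcoeff_neq0 /brk /lin_ext raddf_sum /= => qn0.
  have [t th] : exists2 t, t \in msupp h1 & q = [:: Br t].
    apply: contrapT => nex; case/eqP: qn0; rewrite big_seq big1 // => t th.
    rewrite mcoeffZ mcoeffU1; case: eqP => [qE|_]; last by rewrite mulr0.
    by case: nex; exists t.
  by move=> ->; exists t => //; apply: Hh1.
have gt : good RBW [:: Br t] by apply/RBWP/RBr.
apply/RBWP/good_cat; split=> //; first by apply/good_cat; rewrite tu.
by rewrite hv orbT.
Qed.

End Diamond.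

(* Main.v *)
Require Import Defs.
From HB Require Import structures.
From mathcomp Require Import all_boot all_order all_algebra.
From mathcomp Require Import boolp classical_sets finmap.
From mathcomp Require Import monalg.

Local Open Scope ring_scope.

(** A Rota-Baxter word is a string of letters, each a variable or a bracket
    around a Rota-Baxter word, in which no two brackets are adjacent.  The terms
    of an alternating sequence are words of a single letter, so alternating
    sequences are exactly the Rota-Baxter words cut into their letters
    ([alternatingP]).  The product [dia] differs from concatenation only where
    two brackets meet, which never happens along such a sequence; hence its
    product is the basis element of the word that was cut up
    ([dia_prod_letters]).  Existence follows by cutting [w] into letters, and
    uniqueness because distinct words are distinct basis elements. *)

Definition letters {X : Type} (w : word X) : seq (word X) :=
  [seq [:: l] | l <- w].

(** The two clauses of [alternating] become the two clauses of [good RBW], the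
    fixed-point characterization of [RBW] given by [RBWP]. *)
Lemma alternatingP (X : choiceType) (s : seq (word X)) :
  alternating s <-> exists2 w, RBW w & s = letters w.
Proof.
split=> [[s_mem s_adj]|[w /RBWP[w_br w_adj] ->]].
- have [w sE] : exists w : word X, s = letters w.
    elim: s s_mem {s_adj} => [|b s IHs] s_mem; first by exists [::].
    have [|w ->] := IHs; first by move=> i; apply: (s_mem i.+1).
    move: (s_mem 0%N isT) => /= [[x _ <-]|[u _ <-]].
      by exists (Var x :: w).
    by exists (Br u :: w).
  exists w => //; apply/RBWP; split.
  + move=> u uw; have := s_mem (index (Br u) w).
    rewrite sE size_map index_mem => /(_ uw).
    rewrite (nth_map (Br u)) ?index_mem // nth_index //.
    by case=> [[x _ []]|[v Rv [<-]]].
  + apply/(sortedP (Br [::])) => i lti.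
    have := s_adj i; rewrite sE size_map => /(_ lti).
    rewrite !(nth_map (Br [::])) // 1?ltnW //.
    by case=> -[x _ [xE]]; rewrite /adj -xE ?orbT.
- split=> i; rewrite size_map => lti.
  + rewrite (nth_map (Br [::])) //.
    case lE: (nth _ w i) => [x|u]; first by left; exists x.
    by right; exists u => //; apply: w_br; rewrite -lE mem_nth.
  + rewrite !(nth_map (Br [::])) // 1?ltnW //.
    move/(sortedP (Br [::])): w_adj => /(_ i lti).
    case: (nth _ w i) => [x|u]; first by left; exists x.
    by case: (nth _ w i.+1) => [x|v] //; right; exists x.
Qed.

(** Peeling off the first letter, the induction multiplies one letter by the
    remaining word; they are not both brackets where they meet, so
    [dia_word_cat] applies. *)
Lemma dia_prod_letters (k : comNzRingType) (lam : k) (X : choiceType)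
    (w : word X) :
  sorted (@adj X) w -> dia_prod lam (letters w) = << w >>.
Proof.
elim: w => [|l w IHw] lw_adj; first by rewrite /dia_prod big_nil.
move: lw_adj; rewrite -[l :: w]cat1s sorted_adj_cat => /and3P[_ w_adj lw].
rewrite /dia_prod /letters big_cons.
by rewrite -[X in dia _ _ X]/(dia_prod lam (letters w)) IHw // diaU dia_word_cat.
Qed.

Theorem proposition2p5 (k : comNzRingType) (lam : k) (X : choiceType)
    (w : word X) :
  RBW w ->
  exists! s : seq (word X),
    alternating s /\ << w >> = dia_prod lam s :> {malg k[word X]}.
Proof.
move=> Rw; exists (letters w); split.
  split; first by apply/alternatingP; exists w.
  by have /RBWP[_ w_adj] := Rw; rewrite dia_prod_letters.
move=> _ [/alternatingP[v /RBWP[_ v_adj] ->]].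
rewrite dia_prod_letters // => /(congr1 (fun f => w \in msupp f)).
by rewrite !msuppU1 !inE eqxx => /esym/eqP->.
Qed.
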